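(* Let $$\gamma_7=\sup\left\{\frac{\lambda_1(G)+\lambda_n(G)}{n} : G \text{ a finite simple graph on } n \text{ vertices with odd girth at least } 7\right\}.$$ Then $0.03125\le \gamma_7 < 0.0396$.
   Context: For a finite simple graph $G$ on $n$ vertices, $\lambda_1(G)\ge\cdots\ge\lambda_n(G)$ denote the eigenvalues of its adjacency matrix. The odd girth of $G$ is the length of a shortest odd cycle in $G$; if $G$ is bipartite its odd girth is $\infty$. Thus ''odd girth at least 7'' means $G$ contains no cycle of length 3 or 5. *)

(* Defs.v *)
From mathcomp Require Import all_boot all_order all_algebra.
From mathcomp Require Import all_classical all_reals ereal.

Set Implicit Arguments.
Unset Strict Implicit.
Unset Printing Implicit Defensive.

Import Order.TTheory GRing.Theory Num.Theory.
Local Open Scope classical_set_scope.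
Local Open Scope ring_scope.

Record sgraph (n : nat) := SGraph {
  adj :> rel 'I_n;
  adj_sym : symmetric adj;
  adj_irr : irreflexive adj
}.

Definition adjmx (R : realType) (n : nat) (G : sgraph n) : 'M[R]_n :=
  \matrix_(i < n, j < n) (G i j)%:R.

(* The real eigenvalues of A listed with multiplicity in nonincreasing order.
   The list is unique when it exists, and it exists as soon as the
   characteristic polynomial splits over R, in particular when A is symmetric;
   the default [::] is only reached for other matrices. *)
Definition eigenvalues (R : realType) (n : nat) (A : 'M[R]_n) : seq R :=
  xget [::] [set s : seq R | sorted >=%R s /\
                             char_poly A = \prod_(x <- s) ('X - x%:P)].

(* lambda R G i is the i-th largest adjacency eigenvalue, for 1 <= i <= n. *)
Definition lambda (R : realType) (n : nat) (G : sgraph n) (i : nat) : R :=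
  (eigenvalues (adjmx R G))`_i.-1.

(* ucycle also accepts the empty sequence and, on an edge, sequences of
   length 2, hence the bound on the size. *)
Definition is_cycle (n : nat) (G : sgraph n) (c : seq 'I_n) : Prop :=
  (3 <= size c)%N /\ ucycle G c.

(* The infimum of the empty set is +oo, the odd girth of a bipartite graph. *)
Definition odd_girth (R : realType) (n : nat) (G : sgraph n) : \bar R :=
  ereal_inf [set ((size c)%:R : R)%:E | c in
               [set c : seq 'I_n | is_cycle G c /\ odd (size c)]].

Definition gamma (R : realType) (k : nat) : R :=
  sup [set x : R | exists (n : nat) (G : sgraph n),
         [/\ (0 < n)%N,
             ((k%:R : R)%:E <= odd_girth R G)%E
           & x = (lambda R G 1 + lambda R G n) / n%:R]].

(* Main.v *)
(** Upper bound: put x = lambda_1 and y = - lambda_n. Every eigenvalue t satisfies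
    t + y >= 0, hence 4 t^3 - 3 y^2 t + y^3 = (t + y) (2 t - y)^2 >= 0: this is
    y^3 (1 + T_3(t / y)) for the Chebyshev polynomial T_3. Multiply by t^2 and sum
    over the spectrum. Without 3- and 5-cycles the third and fifth moments
    vanish, and the second moment is at most n x, so keeping only the term
    t = x on the left gives x (x + y) (2 x - y)^2 <= n y^3. The maximum of
    (x - y) / n under this constraint is about 0.03953, below 7 / 177.

    Lower bound: the folded 7-cube, on 64 vertices, has odd girth 7,
    lambda_1 = 7 and lambda_n = -5. *)
Require Import Defs.
From mathcomp Require Import all_boot all_order all_algebra.
From mathcomp Require Import all_classical all_reals ereal.
From mathcomp Require Import complex ring lra.
Set Implicit Arguments.
Unset Strict Implicit.
Unset Printing Implicit Defensive.
Import Order.TTheory GRing.Theory Num.Theory.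
Local Open Scope ring_scope.

(** * Real symmetric matrices *)

Section Spectral.
Local Open Scope sesquilinear_scope.

(** Over [R[i]] the matrix becomes Hermitian, hence normal, and its spectral diagonal is real, so
    [d] can be taken over [R]. *)
Lemma symmetric_spectral (R : rcfType) n (A : 'M[R]_n) : A^T = A ->
  exists (d : 'rV[R]_n) (U : 'M[R[i]]_n), U \is unitarymx /\
    map_mx (real_complex R) A = invmx U *m diag_mx (map_mx (real_complex R) d) *m U.
Proof.
move=> symA; pose B := map_mx (real_complex R) A.
have hB : B \is hermsymmx.
  apply: realsym_hermsym.
    apply/is_hermitianmxP; rewrite expr0 scale1r map_mx_id // /B.
    by rewrite -[in LHS]symA map_trmx.
  by apply/mxOverP => i j; rewrite mxE complex_real.
have rd := hermitian_spectral_diag_real hB.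
have /orthomx_spectralP eB := hermitian_normalmx hB.
have Uu := spectral_unitarymx B.
move: (spectralmx B) (spectral_diag B) Uu rd eB => U D Uu /mxOverP rd eB.
exists (map_mx (@complex.Re R) D), U; split; first exact: Uu.
have <- : D = map_mx (real_complex R) (map_mx (@complex.Re R) D).
  by apply/rowP => j; rewrite !mxE RRe_real.
by [].
Qed.

Lemma char_poly_diagonalized (F : fieldType) n (U : 'M[F]_n) (d : 'rV[F]_n) :
  U \in unitmx ->
  char_poly (invmx U *m diag_mx d *m U) = \prod_j ('X - (d 0 j)%:P).
Proof.
move=> Uunit; transitivity (char_poly (diag_mx d)).
  rewrite /char_poly /char_poly_mx !map_mxM.
  set V := map_mx polyC U; set W := map_mx polyC (invmx U).
  have WV : W *m V = 1%:M by rewrite -map_mxM mulVmx // map_mx1.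
  have XE : 'X%:M = W *m 'X%:M *m V by rewrite scalar_mxC -mulmxA WV mulmx1.
  by rewrite {1}XE -mulmxBl -mulmxBr !det_mulmx mulrAC -det_mulmx WV det1 mul1r.
rewrite char_poly_trig ?diag_mx_is_trig //.
by apply: eq_bigr => j _; rewrite !mxE eqxx mulr1n.
Qed.

Lemma trace_exp_diagonalized (F : fieldType) n (U : 'M[F]_n) (d : 'rV[F]_n) k :
  U \in unitmx ->
  \tr ((invmx U *m diag_mx d *m U) ^+ k) = \sum_j d 0 j ^+ k.
Proof.
move=> Uunit.
have -> : (invmx U *m diag_mx d *m U) ^+ k =
    invmx U *m diag_mx (\row_j d 0 j ^+ k) *m U.
  elim: k => [|k IH].
    have -> : \row_j d 0 j ^+ 0 = const_mx 1 by apply/rowP => j; rewrite !mxE.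
    by rewrite expr0 diag_const_mx mulmx1 mulVmx.
  rewrite exprS IH [LHS]mulmxA mulmxA mulmxK //.
  rewrite -[_ *m diag_mx _ *m diag_mx _]mulmxA mulmx_diag.
  by congr (_ *m diag_mx _ *m _); apply/rowP => j; rewrite !mxE exprS.
rewrite mxtrace_mulC mulmxA mulmxV // mul1mx mxtrace_diag.
by apply: eq_bigr => j _; rewrite mxE.
Qed.

(** In the coordinates [v = w *m invmx U] the form is the sum of [d 0 j] times the squared modulus
    of [v 0 j]. *)
Lemma rayleigh_unitary (C : numClosedFieldType) n (U : 'M[C]_n) (d w : 'rV[C]_n)
    (M : C) :
  U \is unitarymx -> (forall j, d 0 j <= M) ->
  (w *m (invmx U *m diag_mx d *m U) *m w^t*) 0 0 <= M * (w *m w^t*) 0 0.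
Proof.
move=> Uu dM; have Uunit := unitarymx_unit Uu.
pose v := w *m invmx U.
have vE : U *m w^t* = v^t* by rewrite /v invmx_unitary // trmx_mul map_mxM trmxCK.
have -> : w *m w^t* = v *m v^t* by rewrite -vE mulmxA mulmxKV.
rewrite !mulmxA -[_ *m U *m _]mulmxA vE -/v !mxE mulr_sumr.
apply: ler_sum => j _; rewrite mul_mx_diag !mxE.
by rewrite mulrAC [leLHS]mulrC ler_wpM2r ?mul_conjC_ge0.
Qed.

Lemma symmetric_eigenvalues (R : rcfType) n (A : 'M[R]_n) : A^T = A ->
  exists d : 'rV[R]_n,
  [/\ char_poly A = \prod_j ('X - (d 0 j)%:P),
      forall k, \tr (A ^+ k) = \sum_j d 0 j ^+ k &
      forall (M : R) (u : 'rV[R]_n), (forall j, d 0 j <= M) ->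
        (u *m A *m u^T) 0 0 <= M * (u *m u^T) 0 0].
Proof.
move=> symA; have [d [U [Uu AE]]] := symmetric_spectral symA.
have Uunit := unitarymx_unit Uu.
exists d; split.
- apply: (map_poly_inj (real_complex R)).
  rewrite map_char_poly AE (char_poly_diagonalized _ Uunit) rmorph_prod.
  by apply: eq_bigr => j _; rewrite rmorphB /= map_polyX map_polyC mxE.
- move=> k; apply: complexI; rewrite -trace_map_mx rmorph_sum.
  have -> : map_mx (real_complex R) (A ^+ k) = map_mx (real_complex R) A ^+ k.
    elim: k => [|k IH]; first by rewrite !expr0 map_mx1.
    by rewrite !exprS map_mxM IH.
  rewrite AE (trace_exp_diagonalized _ _ Uunit).
  by apply: eq_bigr => j _; rewrite mxE rmorphXn.
- move=> M u dM; rewrite -lecR rmorphM /=.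
  have e (v : 'M[R]_1) : real_complex R (v 0 0) = map_mx (real_complex R) v 0 0.
    by rewrite mxE.
  rewrite !e !map_mxM AE.
  have -> : map_mx (real_complex R) u^T = (map_mx (real_complex R) u)^t*.
    by apply/matrixP => i j; rewrite !mxE conj_Creal // complex_real.
  by apply: rayleigh_unitary => // j; rewrite mxE lecR.
Qed.

End Spectral.

(** The sorted diagonal shows that [xget] does not fall back to its default; unique factorization
    makes the chosen list a permutation of that diagonal. *)
Lemma eigenvalues_symmetric (R : realType) n (A : 'M[R]_n) : A^T = A ->
  [/\ sorted >=%R (eigenvalues A),
      char_poly A = \prod_(x <- eigenvalues A) ('X - x%:P),
      forall k, \tr (A ^+ k) = \sum_(x <- eigenvalues A) x ^+ k &
      forall (M : R) (u : 'rV[R]_n), {in eigenvalues A, forall x, x <= M} ->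
        (u *m A *m u^T) 0 0 <= M * (u *m u^T) 0 0].
Proof.
move=> symA; have [d [cA tA rA]] := symmetric_eigenvalues symA.
pose s := [seq d 0 j | j <- enum 'I_n].
have ss : perm_eq (sort >=%R s) s by rewrite perm_sort.
have [sE cE] : sorted >=%R (eigenvalues A) /\
    char_poly A = \prod_(x <- eigenvalues A) ('X - x%:P).
  rewrite /eigenvalues; case: xgetP => [_ -> //|/(_ (sort >=%R s)) []].
  split; first by apply: sort_sorted => x y; exact: le_total.
  by rewrite cA (perm_big _ ss) big_map big_enum.
have pE : perm_eq (eigenvalues A) s.
  by apply: prod_XsubC_eq; rewrite -cE cA big_map big_enum.
split => // [k|M u hM].
  by rewrite tA (perm_big _ pE) big_map big_enum.
by apply: rA => j; apply: hM; rewrite (perm_mem pE); apply: map_f; rewrite mem_enum.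
Qed.

(** * The upper bound *)

Section Graph.
Variables (R : realType) (n : nat) (G : sgraph n).

Lemma adjmx_sym : (adjmx R G)^T = adjmx R G.
Proof. by apply/matrixP => i j; rewrite !mxE adj_sym. Qed.

(** Keeps the index [i.-1] in [lambda] within range, away from the default 0 of [nth]. *)
Lemma size_adj_eigenvalues : size (eigenvalues (adjmx R G)) = n.
Proof.
have [_ cE _ _] := eigenvalues_symmetric adjmx_sym.
have := size_char_poly (adjmx R G); rewrite cE size_prod_XsubC.
by move=> [].
Qed.

Lemma mem_adj_eigenvalues x :
  (x \in eigenvalues (adjmx R G)) = eigenvalue (adjmx R G) x.
Proof.
have [_ cE _ _] := eigenvalues_symmetric adjmx_sym.
by rewrite eigenvalue_root_char cE root_prod_XsubC.
Qed.

Lemma lambda_mem i : (0 < i <= n)%N -> lambda R G i \in eigenvalues (adjmx R G).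
Proof.
case: i => // i /= lt_in; apply: mem_nth.
by rewrite size_adj_eigenvalues.
Qed.

Lemma le_lambda1 x : x \in eigenvalues (adjmx R G) -> x <= lambda R G 1.
Proof.
have [sE _ _ _] := eigenvalues_symmetric adjmx_sym.
move=> /(nthP 0)[i lti <-].
have := sorted_leq_nth (rev_trans le_trans) (@lexx _ R) 0 sE.
by move=> /(_ 0%N i); apply; rewrite ?inE //; case: (eigenvalues _) lti.
Qed.

Lemma ge_lambdan x : x \in eigenvalues (adjmx R G) -> lambda R G n <= x.
Proof.
have [sE _ _ _] := eigenvalues_symmetric adjmx_sym.
move=> /(nthP 0)[i lti <-].
have := sorted_leq_nth (rev_trans le_trans) (@lexx _ R) 0 sE.
rewrite size_adj_eigenvalues in lti.
have n0 : (0 < n)%N by case: (n) lti.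
move=> /(_ i n.-1); apply; rewrite ?inE ?size_adj_eigenvalues ?prednK //.
by rewrite -ltnS prednK.
Qed.

(** The existence of a walk, rather than the number of walks, suffices to make odd traces vanish. *)
Lemma adjmx_exp_walk k i j : (adjmx R G ^+ k) i j != 0 ->
  exists p, [/\ path G i p, size p = k & last i p = j].
Proof.
elim: k i => [|k IH] i.
  rewrite expr0 mxE; have [->|_] := eqVneq i j; last by rewrite eqxx.
  by exists [::].
rewrite exprS mxE => nz.
have [l] : exists l, adjmx R G i l * (adjmx R G ^+ k) l j != 0.
  apply/existsP; apply: contraNT nz; rewrite negb_exists => /forallP h.
  by rewrite big1 // => l _; apply/eqP; rewrite -[_ == _]negbK.
rewrite mulf_eq0 negb_or => /andP[Ail /IH[p [pp sp lp]]].
exists (l :: p); split; rewrite //= ?sp ?pp ?andbT //.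
by move: Ail; rewrite mxE; case: (G i l); rewrite ?eqxx.
Qed.

(** Both sides count ordered adjacent pairs. The right side is a quadratic form at the all-ones
    vector, ready for the Rayleigh bound. *)
Lemma trace_adjmx2 :
  \tr (adjmx R G ^+ 2) = ((const_mx 1 : 'rV[R]_n) *m adjmx R G *m (const_mx 1 : 'rV[R]_n)^T) 0 0.
Proof.
rewrite expr2 !mxE /mxtrace.
transitivity (\sum_i \sum_j adjmx R G i j).
  apply: eq_bigr => i _; rewrite mxE; apply: eq_bigr => j _.
  by rewrite !mxE [G j i]adj_sym; case: (G i j); rewrite ?mulr1 ?mulr0.
rewrite exchange_big; apply: eq_bigr => j _ /=; rewrite !mxE mulr1.
by apply: eq_bigr => i _; rewrite !mxE mul1r.
Qed.

Hypothesis og : ((7%:R : R)%:E <= odd_girth R G)%E.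

Lemma odd_cycle_size c : is_cycle G c -> odd (size c) -> (7 <= size c)%N.
Proof.
move=> cc oc.
rewrite -(ler_nat R) -lee_fin; apply: (le_trans og).
by apply: ereal_inf_lbound; exists c.
Qed.

Lemma no_triangle a b c : G a b -> G b c -> G c a -> False.
Proof.
move=> ab bc ca.
have ne x y : G x y -> x != y by apply: contraTneq => ->; rewrite adj_irr.
have : is_cycle G [:: a; b; c].
  split=> //; rewrite /ucycle /= ab bc ca /= !inE negb_or.
  by rewrite (ne _ _ ab) (ne _ _ bc) (eq_sym a c) (ne _ _ ca).
by move=> /odd_cycle_size /(_ isT).
Qed.

(** If two vertices two steps apart on a closed 5-walk coincide, removing the backtrack leaves a
    triangle; otherwise the walk is a 5-cycle. *)
Lemma no_pentagon a b c d e : G a b -> G b c -> G c d -> G d e -> G e a -> False.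
Proof.
move=> ab bc cd de ea.
have ne x y : G x y -> x != y by apply: contraTneq => ->; rewrite adj_irr.
have [ac|ac] := eqVneq a c; first by subst c; apply: (no_triangle cd de ea).
have [bd|bd] := eqVneq b d; first by subst d; apply: (no_triangle de ea ab).
have [ce|ce] := eqVneq c e; first by subst e; apply: (no_triangle ea ab bc).
have [da|ad] := eqVneq d a; first by subst d; apply: (no_triangle ab bc cd).
have [eb|be] := eqVneq e b; first by subst e; apply: (no_triangle bc cd de).
have : is_cycle G [:: a; b; c; d; e].
  split=> //; rewrite /ucycle /= ab bc cd de ea /= !inE !negb_or.
  rewrite ac bd ce (eq_sym a d) ad (eq_sym b e) be.
  by rewrite (ne _ _ ab) (ne _ _ bc) (ne _ _ cd) (ne _ _ de) (eq_sym a e) (ne _ _ ea).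
by move=> /odd_cycle_size /(_ isT).
Qed.

Lemma trace_adjmx_odd k : k \in [:: 1; 3; 5]%N -> \tr (adjmx R G ^+ k) = 0.
Proof.
move=> hk; rewrite /mxtrace big1 // => i _; apply/eqP/negPn/negP.
move=> /adjmx_exp_walk [p []]; move: hk; rewrite !inE => /or3P[] /eqP->.
- by case: p => [|a [|]] //=; rewrite andbT => ia _ ai; move: ia; rewrite ai adj_irr.
- case: p => [|a [|b [|c [|]]]] //= /and4P[ia ab bc _] _ ci; subst c.
  exact: (no_triangle ia ab bc).
- case: p => [|a [|b [|c [|d [|e [|]]]]]] //=.
  move=> /and5P[ia ab bc cd /andP[de _]] _ ei; subst e.
  exact: (no_pentagon ia ab bc cd de).
Qed.

End Graph.

(** * From the moment inequality to the constant 7/177 *)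

Lemma quartic_bound (R : realFieldType) (x y : R) : 0 <= x -> 0 <= y ->
  (x - y) * y ^+ 3 <= 7 / 177 * (x * (x + y) * (2 * x - y) ^+ 2).
Proof.
move=> x0 y0; have [xy|yx] := ltP x y.
  apply: (@le_trans _ _ 0).
    by rewrite mulr_le0_ge0 ?exprn_ge0 // subr_le0 ltW.
  apply: mulr_ge0; first by rewrite divr_ge0 ?ler0n.
  by apply: mulr_ge0; rewrite ?sqr_ge0 // mulr_ge0 // addr_ge0.
rewrite -subr_ge0; set u := x - y; have u0 : 0 <= u by rewrite subr_ge0.
have -> : x = u + y by rewrite subrK.
(* 1/4 is near the value of u/y at which the bound is almost tight. *)
pose a : R := 1 / 4.
(* The first two terms absorb [u ^+ 4] and [u ^+ 3 * y]; what remains is [y ^+ 2] times a quadratic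
   form of negative discriminant. *)
have -> : 7 / 177 * ((u + y) * (u + y + y) * (2 * (u + y) - y) ^+ 2)
    - u * y ^+ 3 =
  7 / 177 * (4 * (u ^+ 2 - a ^+ 2 * y ^+ 2) ^+ 2 + 16 * (u * y) * (u - a * y) ^+ 2
   + y ^+ 2 * ((21 + 32 * a + 8 * a ^+ 2) * u ^+ 2
      + (11 - 16 * a ^+ 2 - 177 / 7) * (u * y) + (2 - 4 * a ^+ 4) * y ^+ 2)).
  by rewrite /a; field.
apply: mulr_ge0; first by rewrite divr_ge0 ?ler0n.
apply: addr_ge0; first apply: addr_ge0.
- by rewrite mulr_ge0 ?ler0n ?sqr_ge0.
- by rewrite mulr_ge0 ?sqr_ge0 // mulr_ge0 ?ler0n // mulr_ge0.
rewrite mulr_ge0 ?sqr_ge0 // /a.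
(* 7/27 is close to the ratio [u / y] that minimises this quadratic form. *)
have := sqr_ge0 (u - 7 / 27 * y); have := sqr_ge0 y; have := sqr_ge0 u.
move: (mulr_ge0 u0 y0); lra.
Qed.

Lemma lambda_sum_le (R : realType) (n : nat) (G : sgraph n) : (0 < n)%N ->
  ((7%:R : R)%:E <= odd_girth R G)%E ->
  lambda R G 1 + lambda R G n <= 7 / 177 * n%:R.
Proof.
move=> n0 og.
have [_ _ trE ray] := eigenvalues_symmetric (adjmx_sym R G).
set s := eigenvalues _ in trE ray.
set x := lambda R G 1; set z := lambda R G n.
have xs : x \in s by apply: lambda_mem.
have zs : z \in s by apply: lambda_mem; rewrite n0 leqnn.
have trO k : k \in [:: 1; 3; 5]%N -> \sum_(t <- s) t ^+ k = 0.
  by move=> hk; rewrite -trE (trace_adjmx_odd og).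
have sum2 : \sum_(t <- s) t ^+ 2 <= x * n%:R.
  rewrite -trE trace_adjmx2; apply: le_trans (ray x _ _) _.
    by move=> t; exact: le_lambda1.
  rewrite mxE (eq_bigr (fun=> 1)); last by move=> j _; rewrite !mxE mulr1.
  by rewrite sumr_const card_ord.
(* The trace is zero, so the eigenvalues cannot all be positive, nor, for [x0], all negative. *)
have z0 : z <= 0.
  rewrite leNgt; apply/negP => zp; have := trO 1%N isT.
  suff : z <= \sum_(t <- s) t ^+ 1 by move=> h e; rewrite e in h; move: zp; rewrite ltNge h.
  rewrite (big_rem z) //= expr1 lerDl big_seq sumr_ge0 // => t /mem_rem ts.
  by rewrite expr1; apply: ltW; apply: lt_le_trans zp _; exact: ge_lambdan.
have x0 : 0 <= x.
  rewrite leNgt; apply/negP => xn; have := trO 1%N isT.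
  suff : \sum_(t <- s) t ^+ 1 <= x by move=> h e; rewrite e in h; move: xn; rewrite ltNge h.
  rewrite (big_rem x) //= expr1 gerDl big_seq sumr_le0 // => t /mem_rem ts.
  by rewrite expr1; apply: ltW; apply: le_lt_trans xn; exact: le_lambda1.
have main : x ^+ 2 * ((x - z) * (2 * x + z) ^+ 2) <= - z ^+ 3 * (x * n%:R).
  (* All summands are nonnegative, and the left side is the one at [t = x]. *)
  apply: (@le_trans _ _ (\sum_(t <- s) t ^+ 2 * ((t - z) * (2 * t + z) ^+ 2))).
    rewrite (big_rem x) //= lerDl big_seq sumr_ge0 // => t /mem_rem ts.
    by rewrite mulr_ge0 ?sqr_ge0 // mulr_ge0 ?sqr_ge0 // subr_ge0 ge_lambdan.
  have -> : \sum_(t <- s) t ^+ 2 * ((t - z) * (2 * t + z) ^+ 2) =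
      \sum_(t <- s) (4 * t ^+ 5 - 3 * z ^+ 2 * t ^+ 3 - z ^+ 3 * t ^+ 2).
    by apply: eq_bigr => t _; ring.
  rewrite !sumrB -!mulr_sumr (trO 5%N) // (trO 3%N) // !mulr0 subrr sub0r -mulNr.
  by apply: ler_wpM2l => //; rewrite oppr_ge0 exprn_odd_le0.
have [->|xn0] := eqVneq x 0.
  by rewrite add0r (le_trans z0) // mulr_ge0 ?ler0n // divr_ge0 ?ler0n.
have xp : 0 < x by rewrite lt_def xn0.
have := quartic_bound x0 (y := - z); rewrite oppr_ge0 => /(_ z0).
have {}main : x * (x - z) * (2 * x + z) ^+ 2 <= - z ^+ 3 * n%:R.
  by rewrite -(ler_pM2l xp); lra.
rewrite !opprK => q.
have {}q : (x + z) * - z ^+ 3 <= 7 / 177 * n%:R * - z ^+ 3.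
  by lra.
(* For [z = 0] the factor [- z ^+ 3] cannot be cancelled, but then [main] bounds a positive quantity
   by 0. *)
have [z0'|zn0] := eqVneq z 0; last first.
  by rewrite -(ler_pM2r (x := - z ^+ 3)) // oppr_gt0 exprn_odd_lt0 // lt_def eq_sym zn0.
move: main; rewrite z0' !subr0 !addr0 expr0n /= oppr0 mul0r leNgt.
by rewrite !mulr_gt0 // exprn_gt0 // mulr_gt0.
Qed.

(** * The folded 7-cube *)

(* The 7-cube modulo antipodes: normalise the last coordinate to 0, so that
   flipping it amounts to flipping the other six. *)
Definition cubevertex := 'rV['F_2]_6.

Definition cubegen (o : option 'I_6) : cubevertex :=
  if o is Some i then delta_mx 0 i else const_mx 1.

Definition cubeadj : rel cubevertex := [rel x y | [exists o, y == x + cubegen o]].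

Lemma cubevertex_addxx (x : cubevertex) : x + x = 0.
Proof. by apply/rowP => i; rewrite !mxE addrr_pchar2 // pchar_Fp. Qed.

Lemma cubeadj_sym : symmetric cubeadj.
Proof.
suff h x y : cubeadj x y -> cubeadj y x by move=> x y; apply/idP/idP; exact: h.
case/existsP => o /eqP ->; apply/existsP; exists o.
by rewrite -addrA cubevertex_addxx addr0.
Qed.

Lemma cubegen_neq0 o : cubegen o != 0.
Proof.
case: o => [i|] /=; apply/negP => /eqP/rowP; last by move=> /(_ 0); rewrite !mxE.
by move=> /(_ i); rewrite !mxE !eqxx.
Qed.

Lemma cubegen_inj : injective cubegen.
Proof.
have h (i : 'I_6) : delta_mx 0 i <> const_mx 1 :> cubevertex.
  (* [lift i 0] is a coordinate other than [i], where the unit vector vanishes. *)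
  by move=> /rowP /(_ (lift i 0)) /eqP; rewrite !mxE [_ == i]eq_sym (negPf (neq_lift i 0)).
move=> [i|] [j|] //= e; last 2 first.
- by case: (h i).
- by case: (h j).
congr Some; apply/eqP; move/rowP/(_ i): e; rewrite !mxE !eqxx.
by case: eqP.
Qed.

Lemma cubeadj_irr : irreflexive cubeadj.
Proof.
move=> x; apply/existsP => -[o]; rewrite -{1}[x]addr0 (inj_eq (addrI x)) eq_sym.
by rewrite (negPf (cubegen_neq0 o)).
Qed.

Definition folded_7cube : sgraph #|{: cubevertex}| :=
  SGraph (adj := [rel i j | cubeadj (enum_val i) (enum_val j)])
    (fun i j => cubeadj_sym _ _) (fun i => cubeadj_irr _).

Lemma card_cubevertex : #|{: cubevertex}| = 64%N.
Proof. by rewrite card_mx card_Fp. Qed.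

(** A closed walk thus yields a relation among the generators, which reduces the odd girth to a
    parity count. *)
Lemma folded_7cube_walk i p : path folded_7cube i p ->
  exists2 e : seq (option 'I_6), size e = size p &
    enum_val (last i p) = enum_val i + \sum_(o <- e) cubegen o.
Proof.
elim: p i => [|j p IH] i /=; first by exists [::]; rewrite ?big_nil ?addr0.
case/andP => /existsP[o /eqP ij] /IH[e se le].
by exists (o :: e); rewrite /= ?se // le ij big_cons addrA.
Qed.

Lemma big_option (V : Type) (idx : V) (op : Monoid.com_law idx) (T : finType)
    (F : option T -> V) :
  \big[op/idx]_o F o = op (F None) (\big[op/idx]_i F (Some i)).
Proof.
rewrite (bigD1 None) //= (reindex_omap Some id); last by case.
by congr (op _ _); apply: eq_bigl => i; rewrite eqxx.
Qed.

(* In a relation all seven generators occur with the same parity. *)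
Lemma size_cubegen_relation (e : seq (option 'I_6)) :
  \sum_(o <- e) cubegen o = 0 -> odd (size e) -> (7 <= size e)%N.
Proof.
move=> e0 oe.
(* Only the generators [Some i] and [None] affect coordinate [i]. *)
have coord i : odd (count_mem (Some i) e + count_mem None e) = false.
  have /rowP/(_ i) := e0; rewrite !mxE summxE.
  have -> : \sum_(o <- e) cubegen o 0 i = (count_mem (Some i) e + count_mem None e)%:R.
    elim: (e) => [|o s IH]; first by rewrite big_nil.
    rewrite big_cons IH /= addnACA [RHS]natrD; congr (_ + _).
    case: o => [j|] /=; last by rewrite mxE.
    by rewrite mxE eqxx (inj_eq Some_inj) addn0 eq_sym.
  move=> /eqP; rewrite -(dvdn_pcharf (pchar_Fp (isT : prime 2))) dvdn2.
  exact: negbTE.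
have sE : size e = (count_mem None e + \sum_(i < 6) count_mem (Some i) e)%N.
  elim: (e) => [|o s IH]; first by rewrite /= big1.
  rewrite /= IH big_split /= addnACA -addn1 addnC; congr (_ + _)%N.
  case: o => [j|]; last by rewrite eqxx big1.
  rewrite (bigD1 j) //= eqxx big1 // => i; rewrite eq_sym => /negPf h.
  by rewrite (inj_eq Some_inj) h.
have {}coord i : odd (count_mem (Some i) e) = odd (count_mem None e).
  by move: (coord i); rewrite oddD; do 2 case: odd.
(* Seven counts of equal parity have an odd sum, so each is odd and hence at least 1. *)
have oddN : odd (count_mem None e).
  move: oe; rewrite sE oddD; apply: contraLR => /negPf h; rewrite h /=.
  rewrite (big_morph odd oddD (erefl : odd 0 = false)).
  by rewrite big1 // => i _; rewrite coord.
rewrite sE (leq_add (m1 := 1) (m2 := 6)) ?odd_gt0 //.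
rewrite -[X in (X <= _)%N](card_ord 6) -sum1_card leq_sum // => i _.
by rewrite odd_gt0 // coord.
Qed.

Lemma folded_7cube_odd_girth (R : realType) :
  ((7%:R : R)%:E <= odd_girth R folded_7cube)%E.
Proof.
apply/ereal_infP => _ [c [[_ /andP[cc _]] oc] <-].
rewrite lee_fin ler_nat; case: c cc oc => // x p.
move=> /folded_7cube_walk [e]; rewrite last_rcons size_rcons => se e0 oc.
rewrite [size _]/= -se; apply: size_cubegen_relation; last by rewrite se.
by apply: (addrI (enum_val x)); rewrite addr0 -e0.
Qed.

(** * Extreme eigenvalues of the folded 7-cube *)

Section Spectrum.
Variable R : realType.
Let A := adjmx R folded_7cube.

(** Turns eigenvectors into functions on the group, on which translations act and commute with
    [A]. *)
Lemma folded_7cube_mulmx (v : 'rV[R]_#|{: cubevertex}|) x :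
  (v *m A) 0 (enum_rank x) = \sum_o v 0 (enum_rank (x + cubegen o)).
Proof.
rewrite mxE (reindex (@enum_rank _)) /=; last exact/onW_bij/enum_rank_bij.
under eq_bigr do rewrite mxE /= !enum_rankK.
transitivity (\sum_(y in [set x + cubegen o | o : option 'I_6]) v 0 (enum_rank y)).
  rewrite [RHS]big_mkcond; apply: eq_bigr => y _.
  rewrite cubeadj_sym; case: imsetP => [[o _ ->]|h].
    by rewrite (_ : cubeadj _ _) ?mulr1 //; apply/existsP; exists o.
  rewrite (_ : cubeadj _ _ = false) ?mulr0 //; apply/existsP => -[o /eqP yo].
  by apply: h; exists o.
rewrite big_imset //= => o1 o2 _ _ /addrI; exact: cubegen_inj.
Qed.

(* If f(x) + f(x + g) is nonzero it is invariant under translation by g;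
   otherwise f itself changes sign under this translation. *)
Lemma common_sign_vector (t : R) (f : cubevertex -> R) (gs : seq cubevertex) :
    (forall x, \sum_o f (x + cubegen o) = t * f x) -> (exists x, f x != 0) ->
  exists f' : cubevertex -> R,
  [/\ forall x, \sum_o f' (x + cubegen o) = t * f' x, exists x, f' x != 0 &
      forall g, g \in gs -> exists b : bool, forall x, f' (x + g) = (-1) ^+ b * f' x].
Proof.
move=> Hf nzf; elim: gs => [|g gs [f1 [H1 nz1 E1]]]; first by exists f.
have [/existsP[x0 nz]|] := boolP [exists x, f1 x + f1 (x + g) != 0].
  (* Translations commute, so symmetrising along [g] preserves the eigenvalue equation and the signs
     already obtained. *)
  exists (fun x => f1 x + f1 (x + g)); split; last 2 first.
  - by exists x0.
  - move=> h; rewrite inE => /orP[/eqP->|/E1[b hb]].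
      by exists false => x; rewrite -addrA cubevertex_addxx addr0 mul1r addrC.
    by exists b => x; rewrite mulrDr -!hb addrAC.
  move=> x; rewrite mulrDr -!H1 -big_split /=.
  by apply: eq_bigr => o _; rewrite addrAC.
rewrite negb_exists => /forallP h; exists f1; split => // g'.
rewrite inE => /orP[/eqP->|/E1 //]; exists true => x.
by apply/eqP; rewrite expr1 mulN1r -addr_eq0 addrC -[_ == _]negbK h.
Qed.

Lemma cubegen_sum0 : \sum_o cubegen o = 0.
Proof.
rewrite big_option; apply/rowP => i; rewrite !mxE summxE (bigD1 i) //= !mxE !eqxx.
rewrite big1 ?addr0 => [|j /negPf ji]; last by rewrite !mxE eq_sym ji andbF.
by apply/eqP.
Qed.

(** On a common sign vector [t] is a sum of seven signs. Their product is 1, so at least one sign is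
    positive and the sum is at least 1 - 6. *)
Lemma folded_7cube_eigenvalue_ge (t : R) : eigenvalue A t -> -5 <= t.
Proof.
move=> /eigenvalueP[v vA nzv].
have [] := @common_sign_vector t (fun x => v 0 (enum_rank x)) (map cubegen (enum {: option 'I_6})).
- by move=> x; rewrite -folded_7cube_mulmx vA mxE.
- apply/existsP; rewrite -negb_forall; apply: contraNN nzv => /forallP h.
  by apply/eqP/rowP => j; rewrite mxE -[j]enum_valK; apply/eqP.
move=> f [Hf [x nz] sg].
have {}sg o : {b : bool | forall y, f (y + cubegen o) = (-1) ^+ b * f y}.
  by apply/cid/sg/map_f; rewrite mem_enum.
pose b o := sval (sg o); have bE o : forall y, f (y + cubegen o) = (-1) ^+ b o * f y.
  exact: (svalP (sg o)).
have tE : t = \sum_o (-1) ^+ b o.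
  apply: (mulIf nz); rewrite -Hf mulr_suml; apply: eq_bigr => o _; exact: bE.
(* Translating by all seven generators in turn returns to [x], since they sum to 0. *)
have pb : \prod_o (-1) ^+ b o = 1 :> R.
  apply: (mulIf nz); rewrite mul1r -{2}[x]addr0 -cubegen_sum0.
  elim/big_rec2: _ => [|o y r _ IH]; first by rewrite addr0 mul1r.
  have -> : x + (cubegen o + y) = x + y + cubegen o by rewrite addrCA addrC.
  by rewrite bE -mulrA IH.
rewrite tE; have [/forallP h|] := boolP [forall o, b o].
  move: pb; under eq_bigr => o _ do rewrite h expr1.
  rewrite prodr_const card_option card_ord -signr_odd expr1 => pb.
  by have := @ltr01 R; rewrite -pb oppr_gt0 ltr10.
rewrite negb_forall => /existsP[o /negPf bo].
have -> : -5 = 1 + \sum_(o' | o' != o) (-1) :> R.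
  rewrite sumr_const; have -> : #|[pred o' : option 'I_6 | o' != o]| = 6%N.
    by have := cardC1 o; rewrite card_option card_ord.
  by ring.
rewrite [leRHS](bigD1 o) //= bo lerD2l ler_sum // => o' _.
by case: (b o'); rewrite ?expr1 ?expr0 // (le_trans _ ler01) // oppr_le0.
Qed.

Lemma folded_7cube_eigenvalue7 : eigenvalue A 7.
Proof.
apply/eigenvalueP; exists (const_mx 1).
  apply/rowP => j; rewrite -[j]enum_valK folded_7cube_mulmx !mxE.
  under eq_bigr do rewrite mxE.
  by rewrite sumr_const card_option card_ord mulr1.
apply/eqP => /rowP /(_ (enum_rank 0)); rewrite !mxE; apply/eqP; exact: oner_neq0.
Qed.

End Spectrum.

Lemma folded_7cube_lambda_sum (R : realType) :
  2 <= lambda R folded_7cube 1 + lambda R folded_7cube #|{: cubevertex}|.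
Proof.
have l1 : 7 <= lambda R folded_7cube 1.
  by apply: le_lambda1; rewrite mem_adj_eigenvalues folded_7cube_eigenvalue7.
have ln : -5 <= lambda R folded_7cube #|{: cubevertex}|.
  apply: folded_7cube_eigenvalue_ge; rewrite -mem_adj_eigenvalues lambda_mem //.
  by rewrite leqnn card_cubevertex.
lra.
Qed.

Theorem theorem1p4 (R : realType) :
  3125 / 10 ^+ 5 <= gamma R 7 /\ gamma R 7 < 396 / 10 ^+ 4.
Proof.
pose E : set R := [set x : R | exists (n : nat) (G : sgraph n),
  [/\ (0 < n)%N, ((7%:R : R)%:E <= odd_girth R G)%E
    & x = (lambda R G 1 + lambda R G n) / n%:R]]%classic.
have -> : gamma R 7 = sup E by [].
have ubE : ubound E (7 / 177).
  move=> _ [n [G [n0 og ->]]]; rewrite ler_pdivrMr ?ltr0n //.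
  exact: lambda_sum_le.
have cubeE : E ((lambda R folded_7cube 1 + lambda R folded_7cube #|{: cubevertex}|) /
    #|{: cubevertex}|%:R).
  exists _, folded_7cube; split=> //; last exact: folded_7cube_odd_girth.
  by rewrite card_cubevertex.
split.
  (* The set must be bounded above for its [sup] to dominate the value of the cube, which is at
     least 2/64 = 0.03125. *)
  apply: le_trans (ub_le_sup _ cubeE); last by exists (7 / 177).
  rewrite [X in _ / X%:R]card_cubevertex ler_pdivlMr ?ltr0n //.
  apply: le_trans (folded_7cube_lambda_sum R); lra.
apply: le_lt_trans (_ : 7 / 177 < _); last lra.
(* The cube also supplies the nonemptiness required to bound [sup] from above. *)
by apply: ge_sup => //; eexists; exact: cubeE.
Qed.
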